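(* Let $(X,\phi)$ be a non-compact, connected calibrated manifold. The following two conditions are equivalent. 1) $K\subset\subset X\Rightarrow\widehat K\subset\subset X$, and there exists a strictly $\phi$-plurisubharmonic function defined outside a compact subset of $X$. 2) There exists a $\phi$-plurisubharmonic proper exhaustion function on $X$ which is strictly $\phi$-plurisubharmonic outside a compact subset of $X$.
   Context: A calibrated manifold $(X,\phi)$ of degree $p\ge 1$ is a smooth riemannian manifold $X$ together with a closed smooth $p$-form $\phi$ such that $\phi(\xi)\le 1$ for every unit simple tangent $p$-vector $\xi$ on $X$. $G_x(\phi)$ denotes the set of unit simple $p$-vectors $\xi$ at $x$ with $\phi(\xi)=1$ ($\phi$-planes), and $G(\phi)=\bigcup_xG_x(\phi)$. For a smooth function $f$ on (an open subset of) $X$, the $\phi$-Hessian of $f$ is the $p$-form $\mathcal H^\phi(f)(v_1,\dots,v_p)=\sum_{i=1}^p\phi(v_1,\dots,\nabla_{v_i}(\nabla f),\dots,v_p)$ ($\nabla_{v_i}(\nabla f)$ in the $i$-th slot, $\nabla$ the Levi-Civita connection). $f$ is $\phi$-plurisubharmonic if $\mathcal H^\phi(f)(\xi)\ge 0$ for all $\phi$-planes $\xi$ at points of its domain, and strictly $\phi$-plurisubharmonic at $x$ if $\mathcal H^\phi(f)(\xi)>0$ for all $\xi\in G_x(\phi)$; it is strictly $\phi$-plurisubharmonic on a set if this holds at each point of the set. $\mathcal{PSH}(X,\phi)$ is the set of all smooth $\phi$-plurisubharmonic functions on $X$. For a compact set $K\subset X$, the $(X,\phi)$-convex hull is $\widehat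 K=\{x\in X: f(x)\le\sup_K f\ \text{for all } f\in\mathcal{PSH}(X,\phi)\}$. The notation $A\subset\subset X$ means that $A$ has compact closure in $X$; the implication in 1) is to be read for all compact $K\subset X$. A proper exhaustion function is a function $f:X\to\mathbb R$ such that $\{x\in X: f(x)\le c\}$ is compact for every $c\in\mathbb R$. *)

(* Defs.v *)
From HB Require Import structures.
From mathcomp Require Import all_boot all_order all_algebra.
From mathcomp Require Import all_classical all_reals all_analysis.

Set Implicit Arguments.
Unset Strict Implicit.
Unset Printing Implicit Defensive.

Import Order.TTheory GRing.Theory Num.Theory.
Import numFieldNormedType.Exports.

Local Open Scope classical_set_scope.
Local Open Scope ring_scope.

(* Everything is written in charts.  Tangent vectors are coordinate row
   vectors, so a tuple (v_1, ..., v_p) of tangent vectors is a matrix in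
   'M[R]_(p, n) with rows v_k, and a linear map with Jacobian J acts on the
   right. *)

Section Euclidean.
Context {R : realType} {n : nat} {V : normedModType R}.

Definition partial (i : 'I_n) (f : 'rV[R]_n -> V) (u : 'rV[R]_n) : V :=
  'D_(delta_mx 0 i) f u.

Definition iter_partial (s : seq 'I_n) (f : 'rV[R]_n -> V) : 'rV[R]_n -> V :=
  foldr partial f s.

(* C^oo on U, for U open: if all iterated partials are Frechet-differentiable
   on U then they are in particular all continuous there, and conversely. *)
Definition smooth_on (U : set 'rV[R]_n) (f : 'rV[R]_n -> V) : Prop :=
  forall (s : seq 'I_n) (u : 'rV[R]_n), U u ->
    differentiable (iter_partial s f) u.

End Euclidean.

(* Only the restrictions of chart_map to chart_dom and of chart_inv to
   chart_map @` chart_dom are meaningful. *)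
Record chart (R : realType) (n : nat) (M : topologicalType) := Chart {
  chart_dom : set M ;
  chart_map :> M -> 'rV[R]_n ;
  chart_inv : 'rV[R]_n -> M ;
  chart_dom_open : open chart_dom ;
  chart_codom_open : open (chart_map @` chart_dom) ;
  chart_mapK : forall x, chart_dom x -> chart_inv (chart_map x) = x ;
  chart_map_continuous : {within chart_dom, continuous chart_map} ;
  chart_inv_continuous :
    {within chart_map @` chart_dom, continuous chart_inv}
}.

Section ChartTheory.
Context {R : realType} {n : nat} {M : topologicalType}.
Implicit Types a b : chart R n M.

Definition chart_codom a : set 'rV[R]_n := a @` chart_dom a.

Definition overlap a b : set 'rV[R]_n := a @` (chart_dom a `&` chart_dom b).

Definition transition a b : 'rV[R]_n -> 'rV[R]_n := b \o chart_inv a.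

End ChartTheory.

(* The smooth structure is given by an atlas, not required to be maximal. *)
Record manifold (R : realType) (n : nat) := Manifold {
  mfd_space :> topologicalType ;
  mfd_hausdorff : hausdorff_space mfd_space ;
  mfd_second_countable : @second_countable mfd_space ;
  mfd_index : Type ;
  mfd_chart : mfd_index -> chart R n mfd_space ;
  mfd_cover : forall x : mfd_space, exists a, chart_dom (mfd_chart a) x ;
  mfd_compatible : forall a b,
    smooth_on (overlap (mfd_chart a) (mfd_chart b))
              (transition (mfd_chart a) (mfd_chart b))
}.

(* met a u is the Gram matrix, at the point with coordinates u in the chart a,
   of the coordinate vector fields of a. *)
Record riemannian_metric (R : realType) (n : nat) (X : manifold R n) :=
  RiemannianMetric {
  met :> mfd_index X -> 'rV[R]_n -> 'M[R]_n ;
  met_smooth : forall a, smooth_on (chart_codom (mfd_chart a)) (met a) ;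
  met_sym : forall a u, chart_codom (mfd_chart a) u -> (met a u)^T = met a u ;
  met_pos : forall a u (v : 'rV[R]_n), chart_codom (mfd_chart a) u ->
    v != 0 -> 0 < (v *m met a u *m v^T) 0 0 ;
  met_transition : forall a b u,
    overlap (mfd_chart a) (mfd_chart b) u ->
    let tau := transition (mfd_chart a) (mfd_chart b) in
    met a u = 'J tau u *m met b (tau u) *m ('J tau u)^T
}.

Section MultilinearForms.
Context {R : realType} {n p : nat}.
Implicit Types (w : 'M[R]_(p, n) -> R) (V : 'M[R]_(p, n)) (x y : 'rV[R]_n).

Definition set_row (i : 'I_p) x V : 'M[R]_(p, n) :=
  \matrix_(k < p) (if k == i then x else row k V).

Definition alternating_form w : Prop :=
  (forall i V (c : R) x y,
     w (set_row i (c *: x + y) V) = c * w (set_row i x V) + w (set_row i y V))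
  /\ (forall (i j : 'I_p) V, i != j -> row i V = row j V -> w V = 0).

(* The value on constant vector fields v_0, ..., v_p of the exterior derivative
   of the p-form w on an open subset of R^n (Lie brackets vanish). *)
Definition ext_deriv (w : 'rV[R]_n -> 'M[R]_(p, n) -> R) (u : 'rV[R]_n)
    (V : 'M[R]_(p.+1, n)) : R :=
  \sum_(i < p.+1) (-1) ^+ i * 'D_(row i V) (fun y => w y (row' i V)) u.

End MultilinearForms.

Record closed_form (R : realType) (n p : nat) (X : manifold R n) :=
  ClosedForm {
  form :> mfd_index X -> 'rV[R]_n -> 'M[R]_(p, n) -> R ;
  form_alternating : forall a u, chart_codom (mfd_chart a) u ->
    alternating_form (form a u) ;
  form_smooth : forall a V,
    smooth_on (chart_codom (mfd_chart a)) (fun u => form a u V) ;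
  form_transition : forall a b u V,
    overlap (mfd_chart a) (mfd_chart b) u ->
    let tau := transition (mfd_chart a) (mfd_chart b) in
    form a u V = form b (tau u) (V *m 'J tau u) ;
  form_closed : forall a u V, chart_codom (mfd_chart a) u ->
    ext_deriv (form a) u V = 0
}.

(* The p-vector v_1 /\ ... /\ v_p has squared norm det (<v_i, v_j>). *)
Definition unit_simple (R : realType) (n p : nat) (g : 'M[R]_n)
    (V : 'M[R]_(p, n)) : Prop :=
  \det (V *m g *m V^T) = 1.

Record calibrated_manifold (R : realType) (n p : nat) := CalibratedManifold {
  cal_mfd :> manifold R n ;
  cal_met : riemannian_metric cal_mfd ;
  cal_form : closed_form p cal_mfd ;
  cal_comass : forall a u V, chart_codom (mfd_chart a) u ->
    unit_simple (cal_met a u) V -> cal_form a u V <= 1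
}.

Section LeviCivita.
Context {R : realType} {n : nat} (g : 'rV[R]_n -> 'M[R]_n).

Definition christoffel (u : 'rV[R]_n) (k i j : 'I_n) : R :=
  2^-1 * \sum_(l < n) invmx (g u) k l *
    (partial i (fun y => g y j l) u + partial j (fun y => g y i l) u
     - partial l (fun y => g y i j) u).

Definition gradient (h : 'rV[R]_n -> R) (u : 'rV[R]_n) : 'rV[R]_n :=
  \row_k \sum_(l < n) invmx (g u) k l * partial l h u.

Definition levi_civita (v : 'rV[R]_n) (W : 'rV[R]_n -> 'rV[R]_n)
    (u : 'rV[R]_n) : 'rV[R]_n :=
  \row_k ('D_v (fun y => W y 0 k) u
          + \sum_(i < n) \sum_(j < n) christoffel u k i j * v 0 i * W u 0 j).

End LeviCivita.

Section Plurisubharmonic.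
Context {R : realType} {n p : nat} (X : calibrated_manifold R n p).
Implicit Types (a : mfd_index X) (x : X) (V : 'M[R]_(p, n)) (f : X -> R)
  (U A K : set X).

(* The rows of V are the coordinates in the chart a of tangent vectors
   v_1, ..., v_p at x such that v_1 /\ ... /\ v_p is a phi-plane; every
   phi-plane at x is of this form, in each chart around x. *)
Definition phi_plane a x V : Prop :=
  let u := mfd_chart a x in
  unit_simple (cal_met X a u) V /\ cal_form X a u V = 1.

Definition phi_hessian f a x V : R :=
  let u := mfd_chart a x in
  let h := f \o chart_inv (mfd_chart a) in
  let g := cal_met X a in
  \sum_(i < p)
    cal_form X a u
      (set_row i (levi_civita g (row i V) (gradient g h) u) V).

(* A function on an open set U is represented by a total function whose
   values outside U are irrelevant. *)
Definition smooth_fun U f : Prop :=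
  forall a, smooth_on (mfd_chart a @` (chart_dom (mfd_chart a) `&` U))
                      (f \o chart_inv (mfd_chart a)).

Definition psh_at f x : Prop :=
  forall a V, chart_dom (mfd_chart a) x -> phi_plane a x V ->
    0 <= phi_hessian f a x V.

Definition strictly_psh_at f x : Prop :=
  forall a V, chart_dom (mfd_chart a) x -> phi_plane a x V ->
    0 < phi_hessian f a x V.

Definition PSH : set (X -> R) :=
  [set f | smooth_fun setT f /\ forall x, psh_at f x].

(* The supremum is taken in \bar R: it is -oo if K is empty. *)
Definition convex_hull K : set X :=
  [set x | forall f, PSH f ->
     ((f x)%:E <= ereal_sup [set (f y)%:E | y in K])%E].

Definition relatively_compact A : Prop := compact (closure A).

Definition proper_exhaustion f : Prop :=
  forall c : R, compact [set x | f x <= c].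

End Plurisubharmonic.

(* Main.v *)
Require Import Defs.
From mathcomp Require Import all_boot all_order all_algebra.
From mathcomp Require Import all_classical all_reals all_analysis.
From mathcomp Require Import ring lra.

Set Implicit Arguments.
Unset Strict Implicit.
Unset Printing Implicit Defensive.

Import Order.TTheory GRing.Theory Num.Theory.
Import numFieldNormedType.Exports.

Local Open Scope classical_set_scope.
Local Open Scope ring_scope.

(** Everything rests on one operation: composing a plurisubharmonic f with a
    convex nondecreasing chi.  Differentiating twice along a phi-plane spanned
    by v_1, ..., v_p gives
      H(chi o f) = chi'(f) H(f) + chi''(f) \sum_i df(v_i) phi(.., grad f, ..),
    where grad f stands in the i-th slot.  The last sum is nonnegative
    ([form_derivation_ge0]): because phi is maximal on phi-planes, it is zero on a
    phi-plane in which one vector has been replaced by a normal one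
    ([first_cousin]), so that only the tangential part of grad f survives, and
    it contributes its squared length.  Hence [PSH] is closed under sums and
    such compositions, and a smooth chi that is zero on the negative axis and
    strictly increasing and convex on the positive one ([theta]) makes it
    possible to cut functions off.

    From convex hulls to an exhaustion ([psh_exhaustion]).  Choose compact sets
    K_0, K_1, ... covering X such that the interior of K_(i+1) contains K_i and
    its hull.  A point outside the hull of K_i is separated from K_i by some f
    in [PSH]; cutting f off and scaling gives a nonnegative g in [PSH] which is
    zero on K_i and as large as desired at the point.  By compactness, some g_i
    of this kind is larger than i on the part of K_(i+2) outside the interior of
    K_(i+1).  The sum of the g_i is locally finite and exhausts X.

    Gluing a strictly plurisubharmonic v at infinity ([glue_at_infinity]).  Let f
    be the exhaustion, with f < c on the compact set off which v is defined.
    Since e^v is bounded on c <= f <= c + 1 and positive everywhere,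
    h = e^v + mu f + b is nonpositive for c <= f <= c + 1/2 and positive for
    f >= c + 1 as soon as mu is large and b is chosen accordingly.  Then
    f + theta(h), continued by f where f <= c, is smooth and plurisubharmonic,
    exhausts X because it is at least f, and is strictly plurisubharmonic where
    f > c + 1.

    In the other direction the hull of K lies in every sublevel set of the
    exhaustion that contains K ([exhaustion_hull]). *)

(** * Smooth functions on open sets of coordinates *)

Lemma near_eq_differentiable (R : realFieldType) (V W : normedModType R)
    (f g : V -> W) (a : V) :
  (\near a, f a = g a) -> differentiable f a -> differentiable g a.
Proof.
move=> fg /diff_locallyP[dfc dfE].
have fga : f a = g a by exact: nbhs_singleton fg.
have fg0 : \forall y \near 0, f (y + a) = g (y + a).
  by move: fg; rewrite (near_shift 0) subr0.
have gE : g \o shift a = cst (g a) + 'd f a +o_ 0 id.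
  apply/eqaddoP => e e0; have /eqaddoP/(_ e e0) := dfE.
  by apply: filterS2 fg0 => y /= fgy; rewrite !fctE /= fgy fga.
apply/diff_locallyP.
by rewrite (diff_unique dfc gE).
Qed.

Section SmoothOn.
Context {R : realType} {n : nat}.
Implicit Types (u : 'rV[R]_n) (f g : 'rV[R]_n -> R) (U W : set 'rV[R]_n).

Lemma near_eq_partial f g u i :
  (\forall y \near u, f y = g y) ->
  \forall y \near u, partial i f y = partial i g y.
Proof.
move=> /near_join; apply: filterS => y /= fg.
exact: near_eq_derive.
Qed.

Lemma near_eq_iter_partial f g u s : (\forall y \near u, f y = g y) ->
  \forall y \near u, iter_partial s f y = iter_partial s g y.
Proof. by move=> fg; elim: s => [|i s IHs] //=; apply: near_eq_partial. Qed.

Lemma smooth_on_subset U W f : W `<=` U -> smooth_on U f -> smooth_on W f.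
Proof. by move=> WU fU s u /WU; apply: fU. Qed.

(** Piecewise defined functions are handled one piece at a time. *)
Lemma smooth_on_local U f :
  (forall u, U u -> exists W g, [/\ nbhs u W, W u, smooth_on W g
     & forall y, W y -> f y = g y]) -> smooth_on U f.
Proof.
move=> fU s u /fU[W [g [nW Wu gW fgW]]].
apply: near_eq_differentiable (gW s u Wu).
by apply: near_eq_iter_partial; near=> y; apply/esym/fgW; near: y.
Unshelve. all: by end_near. Qed.

Lemma partial_smooth_on U f i : smooth_on U f -> smooth_on U (partial i f).
Proof.
move=> fU s u Uu; have := fU (rcons s i) u Uu.
by rewrite /iter_partial foldr_rcons.
Qed.

Lemma smooth_on_differentiable U f u :
  smooth_on U f -> U u -> differentiable f u.
Proof. by move=> fU Uu; exact: (fU [::]). Qed.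

(** Coinduction: differentiating never leads out of [C], so every iterated
    derivative agrees on [U] with a differentiable function. *)
Lemma smooth_on_coind U (C : set ('rV[R]_n -> R)) : open U ->
  (forall f u, C f -> U u -> differentiable f u) ->
  (forall f i, C f -> exists2 g, C g & forall u, U u -> partial i f u = g u) ->
  forall f, C f -> smooth_on U f.
Proof.
move=> oU Cdiff Cpart f Cf s.
suff [g Cg fg] : exists2 g, C g & forall u, U u -> iter_partial s f u = g u.
  move=> u Uu; apply: near_eq_differentiable (Cdiff g u Cg Uu).
  by near=> y; apply/esym/fg; near: y; exact: open_nbhs_nbhs.
elim: s => [|i s [g Cg fg]]; first by exists f.
have [h Ch gh] := Cpart g i Cg; exists h => // u Uu.
rewrite /= -gh//; apply: near_eq_derive.
by near=> y; apply/fg; near: y; exact: open_nbhs_nbhs.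
Unshelve. all: by end_near. Qed.

(** A smooth function of one variable is given with all its derivatives,
    because the chain rule calls for [d k.+1] when [d k \o h] is differentiated
    and the Hessian of a composite involves [d 1] and [d 2]. *)
Definition smooth1 (d : nat -> R -> R) : Prop :=
  forall k (t : R), is_derive t (1 : R) (d k) (d k.+1 t).

Lemma smooth1_differentiable d k t : smooth1 d -> differentiable (d k) t.
Proof. by move=> sd; apply/derivable1_diffP; case: (sd k t). Qed.

Lemma derive_smooth1_comp (h : 'rV[R]_n -> R) d k u v : smooth1 d ->
  differentiable h u -> 'D_v (d k \o h) u = d k.+1 (h u) * 'D_v h u.
Proof.
move=> sd dh; rewrite !deriveE//; last first.
  by apply: differentiable_comp => //; exact: smooth1_differentiable.
rewrite diff_comp//; last exact: smooth1_differentiable.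
rewrite /= diff1E; last exact: smooth1_differentiable.
by rewrite derive1E; case: (sd k (h u)) => _ ->; rewrite mulrC.
Qed.

(** Sums and products are included because the chain and product rules
    produce them; this makes the class stable under partial derivatives. *)
Inductive smooth_closure U (d : nat -> R -> R) : set ('rV[R]_n -> R) :=
| smooth_base f : smooth_on U f -> smooth_closure U d f
| smooth_comp k h : smooth_on U h -> smooth_closure U d (d k \o h)
| smooth_add f g : smooth_closure U d f -> smooth_closure U d g ->
    smooth_closure U d (f + g)
| smooth_mul f g : smooth_closure U d f -> smooth_closure U d g ->
    smooth_closure U d (f * g).

Lemma smooth_closure_smooth U d f : open U -> smooth1 d ->
  smooth_closure U d f -> smooth_on U f.
Proof.
move=> oU sd; move: f.
have Cdiff f u : smooth_closure U d f -> U u -> differentiable f u.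
  move=> + Uu; elim => {f} [f fU|k h hU|f g _ ? _ ?|f g _ ? _ ?].
  - exact: smooth_on_differentiable Uu.
  - apply: differentiable_comp; first exact: smooth_on_differentiable Uu.
    exact: smooth1_differentiable.
  - exact: differentiableD.
  - exact: differentiableM.
apply: smooth_on_coind => // f i.
elim => {f} [f fU|k h hU|f g Cf [f' Cf' ff'] Cg [g' Cg' gg']
                        |f g Cf [f' Cf' ff'] Cg [g' Cg' gg']].
- by exists (partial i f) => //; apply: smooth_base; apply: partial_smooth_on.
- exists ((d k.+1 \o h) * partial i h).
    apply: smooth_mul; first exact: smooth_comp.
    by apply: smooth_base; apply: partial_smooth_on.
  move=> u Uu; rewrite /partial derive_smooth1_comp//.
  exact: smooth_on_differentiable Uu.
- exists (f' + g'); first exact: smooth_add.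
  move=> u Uu; rewrite /partial deriveD; first by rewrite !fctE -ff'// -gg'.
  + by apply: diff_derivable; exact: Cdiff.
  + by apply: diff_derivable; exact: Cdiff.
- exists (f * g' + g * f').
    by apply: smooth_add; exact: smooth_mul.
  move=> u Uu; rewrite /partial deriveM; first by rewrite !fctE -ff'// -gg'.
  + by apply: diff_derivable; exact: Cdiff.
  + by apply: diff_derivable; exact: Cdiff.
Qed.

Lemma smooth_onD U f g : open U -> smooth_on U f -> smooth_on U g ->
  smooth_on U (f + g).
Proof.
move=> oU fU gU; apply: (@smooth_closure_smooth _ (fun _ => cst 0)) => //.
  by move=> k t; exact: is_derive_cst.
by apply: smooth_add; apply: smooth_base.
Qed.

Lemma smooth_on_comp U d h : open U -> smooth1 d -> smooth_on U h ->
  smooth_on U (d 0%N \o h).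
Proof.
by move=> oU sd hU; apply: (smooth_closure_smooth oU sd); apply: smooth_comp.
Qed.

Lemma smooth_on_cst U (c : R) : open U -> smooth_on U (cst c).
Proof.
move=> oU; apply: (@smooth_on_coind _ [set f | exists c, f = cst c]) => //.
- by move=> _ u [c' ->] _; exact: differentiable_cst.
- move=> _ i [c' ->]; exists (cst 0); first by exists 0.
  by move=> u _; rewrite /partial derive_cst.
- by exists c.
Qed.

Lemma derive_partialE f u (v : 'rV[R]_n) : differentiable f u ->
  'D_v f u = \sum_i v 0 i * partial i f u.
Proof.
move=> df; rewrite deriveE// [in LHS](row_sum_delta v) linear_sum.
by apply: eq_bigr => i _; rewrite linearZ /partial deriveE.
Qed.

End SmoothOn.

(** * A flat convex cut-off on the line *)

Section FlatFunctions.
Context {R : realType}.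
Implicit Types (p : {poly R}) (s t : R).

(** Extended by zero, the functions P(1/t) e^(-1/t) form a class that is closed
    under differentiation, even at the origin. *)
Definition flat p t : R := if 0 < t then p.[t^-1] * expR (- t^-1) else 0.

(** e^s = (e^(s/k))^k, and e^(s/k) is at least s/k. *)
Lemma monomial_expR_bound (k : nat) s : 0 <= s ->
  s ^+ k <= k%:R ^+ k * expR s.
Proof.
case: k => [|k] s0; first by rewrite !expr0 mul1r -expR0 ler_expR.
have k0 : (0 : R) < k.+1%:R by rewrite ltr0n.
have -> : expR s = expR (s / k.+1%:R) ^+ k.+1.
  by rewrite -expRM_natl mulrC divfK// gt_eqF.
rewrite -exprMn ler_pXn2r ?nnegrE ?mulr_ge0 ?expR_ge0//.
rewrite -ler_pdivrMl//; apply: le_trans (expR_ge1Dx _).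
by rewrite mulrC lerDr.
Qed.

Lemma poly_expR_bounded p :
  exists2 C, 0 <= C & forall s, 0 <= s -> `|p.[s] * expR (- s)| <= C.
Proof.
exists (\sum_(i < size p) `|p`_i| * i%:R ^+ i).
  by apply: sumr_ge0 => i _; rewrite mulr_ge0// exprn_ge0.
move=> s s0; rewrite normrM (ger0_norm (expR_ge0 _)) expRN.
rewrite ler_pdivrMr ?expR_gt0// horner_coef mulr_suml.
apply: le_trans (ler_norm_sum _ _ _) _; apply: ler_sum => i _.
rewrite normrM -mulrA ler_wpM2l// ger0_norm ?exprn_ge0//.
exact: monomial_expR_bound.
Qed.

(** The bound for the polynomial [p * 'X ^+ 2], read at 1/t; it makes the
    derivative at the origin exist and vanish. *)
Lemma flat_quadratic p : exists2 C, 0 <= C & forall t, `|flat p t| <= C * t ^+ 2.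
Proof.
have [C C0 pC] := poly_expR_bounded (p * 'X ^+ 2); exists C => // t.
rewrite /flat; case: ifPn => t0; last by rewrite normr0 mulr_ge0 ?sqr_ge0.
have := pC t^-1; rewrite invr_ge0 ltW// => /(_ isT).
rewrite -(@ler_pM2r _ (t ^+ 2)) ?exprn_gt0//; apply: le_trans.
rewrite hornerM hornerXn -[X in _ <= _ * X]ger0_norm ?sqr_ge0// -normrM.
rewrite (_ : _ * t ^+ 2 = p.[t^-1] * expR (- t^-1))//.
have tn0 : t != 0 by rewrite gt_eqF.
by field.
Qed.

Lemma is_derive_quadratic (f : R -> R) C : (forall t, `|f t| <= C * t ^+ 2) ->
  is_derive (0 : R) (1 : R) f 0.
Proof.
move=> fC; have f0 : f 0 = 0.
  by apply/eqP; rewrite -normr_le0; have := fC 0; rewrite expr0n mulr0.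
have C0 : 0 <= C by have := fC 1; rewrite expr1n mulr1; apply: le_trans.
have lim0 : (h^-1 *: ((f \o shift 0) (h *: (1 : R)) - f 0)) @[h --> 0^'] --> (0 : R).
  apply/cvgr0Pnorm_le => e e0; near=> h.
  rewrite /= f0 subr0 addr0 [_%:A]mulr1 normrM normfV.
  have h0 : h != 0 by near: h; exact: nbhs_dnbhs_neq.
  rewrite mulrC ler_pdivrMr ?normr_gt0//; apply: le_trans (fC h) _.
  rewrite -real_normK ?num_real// expr2 mulrA ler_wpM2r//.
  have : `|h| <= e / (C + 1) by near: h; apply: dnbhs0_le; rewrite divr_gt0// ltr_wpDl.
  rewrite ler_pdivlMr ?ltr_wpDl// => hC; apply: le_trans hC.
  by rewrite mulrC mulrDr mulr1 lerDl.
apply: DeriveDef; first by apply/cvg_ex; exists 0.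
exact: cvg_lim lim0.
Unshelve. all: by end_near. Qed.

Lemma is_derive_flat p t :
  is_derive t (1 : R) (flat p) (flat ((p - p^`()) * 'X ^+ 2) t).
Proof.
have [t0|t0|->] := ltgtP t 0.
- rewrite [X in is_derive _ _ _ X](_ : _ = 0); last by rewrite /flat ltNge ltW.
  apply: (@near_eq_is_derive _ _ _ (cst 0)).
  near=> y; rewrite /flat ifF//; apply/negbTE; rewrite -leNgt ltW//.
  by near: y; exact: lt_nbhsl.
- pose F (y : R) := p.[y^-1] * expR (- y^-1).
  apply: (@near_eq_is_derive _ _ _ F).
    by near=> y; rewrite /flat ifT//; near: y; exact: lt_nbhsr.
  have dV : is_derive t (1 : R) (fun y => y^-1) (- t ^- 2).
    apply: is_derive_eq; first by apply: is_deriveV; rewrite gt_eqF.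
    by rewrite [_%:A]mulr1.
  have dp : is_derive t (1 : R) (horner p \o (fun y => y^-1)) (p^`().[t^-1] * - t ^- 2).
    have dh : is_derive (t^-1) (1 : R) (horner p) p^`().[t^-1].
      apply: DeriveDef; first exact: derivable_horner.
      by rewrite -derive1E -derivE.
    exact: is_derive1_comp dh dV.
  have de : is_derive t (1 : R) (expR \o (fun y => - y^-1)) (expR (- t^-1) * t ^- 2).
    by apply: is_derive1_comp; apply: is_derive_eq; rewrite opprK.
  apply: (@is_derive_eq _ _ _ _ _ _ _ _ (is_deriveM dp de)).
  rewrite /flat t0 /= hornerM hornerD hornerN hornerXn exprVn /GRing.scale /=.
  ring.
- rewrite [X in is_derive _ _ _ X](_ : _ = 0); last by rewrite /flat ltxx.
  have [C _ pC] := flat_quadratic p.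
  exact: is_derive_quadratic pC.
Unshelve. all: by end_near. Qed.

(** The factor [t] makes the function convex on the whole line: its second
    derivative is t^-3 e^(-1/t), whereas e^(-1/t) is concave for t > 1/2. *)
Definition theta t : R := if 0 < t then t * expR (- t^-1) else 0.

(** The derivatives of [theta] are [flat] functions, starting from
    (1 + 1/t) e^(-1/t). *)
Fixpoint theta_poly (k : nat) : {poly R} :=
  if k is k'.+1 then (theta_poly k' - (theta_poly k')^`()) * 'X ^+ 2
  else 1 + 'X.

Definition thetas k : R -> R :=
  if k is k'.+1 then flat (theta_poly k') else theta.

Lemma theta_le0 t : t <= 0 -> theta t = 0.
Proof. by rewrite /theta leNgt => /negbTE ->. Qed.

Lemma theta_gt0 t : 0 < t -> 0 < theta t.
Proof. by move=> t0; rewrite /theta t0 mulr_gt0// expR_gt0. Qed.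

Lemma theta_ge0 t : 0 <= theta t.
Proof. by have [/theta_le0->//|/theta_gt0/ltW] := lerP t 0. Qed.

Lemma thetaE t : theta t = t * flat 1 t.
Proof.
by rewrite /theta /flat; case: ifP; rewrite ?mulr0// hornerC mul1r.
Qed.

Lemma smooth1_theta : smooth1 thetas.
Proof.
move=> [|k] t; last exact: is_derive_flat.
rewrite /= (_ : theta = id * flat 1); last first.
  by apply/funext => y; rewrite thetaE.
have d1 := is_derive_flat 1 t.
apply: (@is_derive_eq _ _ _ _ _ _ _ _ (is_deriveM (is_derive_id t 1) d1)).
rewrite /flat derivC subr0 mul1r; case: ifPn => t0; rewrite /GRing.scale /=; last first.
  by rewrite !(mulr0, mul0r) addr0.
rewrite !(hornerD, hornerXn, hornerX, hornerC).
have tn0 : t != 0 by rewrite gt_eqF.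
by field.
Qed.

Lemma thetas1_gt0 t : 0 < t -> 0 < thetas 1 t.
Proof.
move=> t0; rewrite /= /flat t0 mulr_gt0 ?expR_gt0// !hornerE.
by rewrite addr_gt0 ?invr_gt0.
Qed.

Lemma thetas1_ge0 t : 0 <= thetas 1 t.
Proof.
have [t0|/thetas1_gt0/ltW//] := lerP t 0.
by rewrite /= /flat ltNge t0.
Qed.

Lemma thetas2_ge0 t : 0 <= thetas 2 t.
Proof.
rewrite /= /flat; case: ifPn => // t0; rewrite mulr_ge0 ?expR_ge0//.
rewrite derivD derivX derivC add0r [1 + 'X]addrC addrK.
by rewrite hornerM hornerXn hornerX mulr_ge0 ?exprn_ge0 ?invr_ge0 ?(ltW t0).
Qed.

Lemma smooth1_expR : smooth1 (fun _ => @expR R).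
Proof. by move=> _ t; exact: is_derive_expR. Qed.

Definition affines (a b : R) (k : nat) (t : R) : R :=
  match k with 0 => a * t + b | 1 => a | _ => 0 end.

Lemma smooth1_affine a b : smooth1 (affines a b).
Proof.
move=> [|[|k]] t; last 2 first.
- exact: is_derive_cst.
- exact: is_derive_cst.
rewrite (_ : affines a b 0 = a *: id + cst b); last first.
  by apply/funext => y; rewrite !fctE.
apply: is_derive_eq.
by rewrite addr0 [_ *: 1]mulr1.
Qed.

End FlatFunctions.

(** * The first cousin principle *)

Section FirstCousin.
Context {R : realType} {n p : nat}.
Variables (g : 'M[R]_n) (w : 'M[R]_(p, n) -> R).
Hypothesis gT : g^T = g.
Hypothesis gpos : forall v : 'rV[R]_n, v != 0 -> 0 < (v *m g *m v^T) 0 0.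
Hypothesis walt : alternating_form w.
Hypothesis comass : forall V, unit_simple g V -> w V <= 1.
Implicit Types (V : 'M[R]_(p, n)) (x y : 'rV[R]_n).

Lemma form_linear i V c x y :
  w (set_row i (c *: x + y) V) = c * w (set_row i x V) + w (set_row i y V).
Proof. by case: walt => + _; apply. Qed.

Lemma form_row0 i V : w (set_row i 0 V) = 0.
Proof.
have := form_linear i V 1 0 0; rewrite scale1r addr0 mul1r => /eqP.
by rewrite -subr_eq0 opprD addNKr oppr_eq0 => /eqP.
Qed.

Lemma form_rowD i V x y :
  w (set_row i (x + y) V) = w (set_row i x V) + w (set_row i y V).
Proof. by rewrite -[x in LHS]scale1r form_linear mul1r. Qed.

Lemma form_rowZ i V c x : w (set_row i (c *: x) V) = c * w (set_row i x V).
Proof. by rewrite -[X in set_row i X V]addr0 form_linear form_row0 addr0. Qed.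

Lemma form_row_sum (I : Type) (r : seq I) i V (F : I -> 'rV[R]_n) :
  w (set_row i (\sum_(k <- r) F k) V) = \sum_(k <- r) w (set_row i (F k) V).
Proof.
elim: r => [|k r IHr]; first by rewrite !big_nil form_row0.
by rewrite !big_cons form_rowD IHr.
Qed.

Lemma set_row_id i V : set_row i (row i V) V = V.
Proof. by apply/row_matrixP => k; rewrite rowK; case: eqP => [->|]. Qed.

Lemma form_row_rows i j V : w (set_row i (row j V) V) = (i == j)%:R * w V.
Proof.
have [<-|ij] := eqVneq i j; first by rewrite set_row_id mul1r.
rewrite mul0r; case: walt => _; apply; first exact: ij.
by rewrite !rowK eqxx eq_sym (negbTE ij).
Qed.

Lemma gram_set_row i V x : x *m g *m V^T = 0 ->
  let V' := set_row i (row i V + x) V in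
  V' *m g *m V'^T =
    V *m g *m V^T + (x *m g *m x^T) 0 0 *: delta_mx i i.
Proof.
move=> xV V'; have V'E : V' = V + delta_mx i 0 *m x.
  apply/matrixP => k l; rewrite !mxE big_ord1 !mxE eqxx andbT.
  by case: eqP => [->|]; rewrite !mxE ?mul1r ?mul0r ?addr0.
have Vx : V *m g *m x^T = 0.
  by apply: trmx_inj; rewrite trmx0 !trmx_mul trmxK gT mulmxA.
have e1 : V *m g *m (delta_mx i 0 *m x)^T = 0.
  by rewrite trmx_mul mulmxA Vx mul0mx.
have e2 : delta_mx i 0 *m x *m g *m V^T = 0 by rewrite -!mulmxA (mulmxA x) xV mulmx0.
have e3 : delta_mx i 0 *m x *m g *m (delta_mx i 0 *m x)^T =
    (x *m g *m x^T) 0 0 *: delta_mx i i.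
  rewrite trmx_mul -!mulmxA (mulmxA g) (mulmxA x) (mulmxA x).
  rewrite {1}[x *m g *m x^T]mx11_scalar mul_scalar_mx -scalemxAr trmx_delta.
  by rewrite mul_delta_mx.
by rewrite V'E linearD /= !mulmxDl !mulmxDr e1 e2 e3 addr0 add0r.
Qed.

Lemma det_rank1 i (A : 'M[R]_p) c :
  \det (A + c *: delta_mx i i) = \det A + c * cofactor A i i.
Proof.
rewrite (determinant_multilinear (A := A + c *: delta_mx i i) (B := A)
  (C := \matrix_k (if k == i then delta_mx 0 i else row k A))
  (i0 := i) (b := 1) (c := c)).
- rewrite mul1r; congr (_ + _ * _).
  rewrite (expand_det_row _ i) (bigD1 i)//= big1 => [|j ji]; last first.
    by rewrite !mxE eqxx mxE eqxx (negbTE ji) mul0r.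
  rewrite !mxE !eqxx mxE !eqxx mul1r addr0 /cofactor; congr (_ * \det _).
  apply/matrixP => k l; rewrite !mxE.
  by rewrite eq_sym (negbTE (neq_lift i k)) mxE.
- by apply/rowP => j; rewrite !mxE !eqxx !mxE eqxx mul1r.
- apply/matrixP => k j.
  by rewrite !mxE eq_sym (negbTE (neq_lift i k)) andFb mulr0 addr0.
- apply/matrixP => k j.
  by rewrite !mxE eq_sym (negbTE (neq_lift i k)) !mxE andFb mulr0 addr0.
Qed.

Lemma gram_det_scale_row i (A : 'M[R]_(p, n)) c x :
  \det (set_row i (c *: x) A *m g *m (set_row i (c *: x) A)^T) =
  c ^+ 2 * \det (set_row i x A *m g *m (set_row i x A)^T).
Proof.
pose d : 'rV[R]_p := \row_k (if k == i then c else 1).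
have -> : set_row i (c *: x) A = diag_mx d *m set_row i x A.
  rewrite mul_diag_mx; apply/matrixP => k l; rewrite !mxE.
  by case: eqP; rewrite ?mxE ?mul1r.
rewrite trmx_mul tr_diag_mx !mulmxA det_mulmx -!mulmxA det_mulmx mulmxA mulrAC.
rewrite det_diag (bigD1 i)//= big1 => [|k ki]; last by rewrite mxE (negbTE ki).
by rewrite mxE eqxx mulr1 expr2.
Qed.

(** The comass bound, made homogeneous by rescaling one row. *)
Lemma form_le_sqrt_gram V (i : 'I_p) : 0 < \det (V *m g *m V^T) ->
  w V <= Num.sqrt (\det (V *m g *m V^T)).
Proof.
move=> D0; set D := \det _; have sD : 0 < Num.sqrt D by rewrite sqrtr_gt0.
have V1 : unit_simple g (set_row i ((Num.sqrt D)^-1 *: row i V) V).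
  rewrite /unit_simple gram_det_scale_row set_row_id -/D exprVn.
  by rewrite sqr_sqrtr ?(ltW D0)// mulVf// gt_eqF.
by have := comass V1; rewrite form_rowZ set_row_id ler_pdivrMl// mulr1.
Qed.

(** The first cousin principle: a phi-plane maximizes the form among unit simple
    p-vectors.  Moving one vector by [t] in a normal direction changes the form
    to first order in [t] but the volume only to second order, so the first
    order term has to vanish. *)
Lemma first_cousin i V x : unit_simple g V -> w V = 1 ->
  x *m g *m V^T = 0 -> w (set_row i x V) = 0.
Proof.
move=> V1 wV1.
suff le0 y : y *m g *m V^T = 0 -> w (set_row i y V) <= 0.
  move=> xV; apply/eqP; rewrite eq_le le0//= -oppr_le0.
  by rewrite -mulN1r -form_rowZ scaleN1r; apply: le0; rewrite !mulNmx xV oppr0.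
move=> yV; rewrite leNgt; apply/negP => F0; set F := w _ in F0.
pose k := (y *m g *m y^T) 0 0 * cofactor (V *m g *m V^T) i i.
have detE t : \det (set_row i (row i V + t *: y) V *m g *m
                   (set_row i (row i V + t *: y) V)^T) = 1 + t ^+ 2 * k.
  rewrite gram_set_row; last by rewrite -!scalemxAl yV scaler0.
  rewrite det_rank1 V1; congr (_ + _).
  rewrite linearZ /= -!scalemxAl -scalemxAr scalerA mxE expr2.
  by rewrite /k mulrA.
have wE t : w (set_row i (row i V + t *: y) V) = 1 + t * F.
  by rewrite form_rowD form_rowZ set_row_id wV1.
(* small enough for both 1 + t^2 k > 0 and t k < 2 F + t F^2 *)
pose t := F / (1 + F ^+ 2 + `|k|).
have D0 : 0 < 1 + F ^+ 2 + `|k| by rewrite !ltr_wpDr ?sqr_ge0.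
have t0 : 0 < t by rewrite divr_gt0.
have tk : t * `|k| <= F.
  rewrite /t mulrAC ler_pdivrMr// ler_wpM2l ?(ltW F0)// lerDr addr_ge0 ?sqr_ge0//.
have t1 : t * F < 1.
  by rewrite /t mulrAC -expr2 ltr_pdivrMr// mul1r; have := normr_ge0 k; lra.
have tFk : t ^+ 2 * `|k| <= t * F by rewrite expr2 -mulrA ler_pM2l.
have tk1 : t ^+ 2 * k <= t ^+ 2 * `|k| by rewrite ler_wpM2l ?sqr_ge0 ?ler_norm.
have tk2 : - (t ^+ 2 * `|k|) <= t ^+ 2 * k.
  by rewrite -mulrN ler_wpM2l ?sqr_ge0// lerNl -normrN ler_norm.
have Dt : 0 < 1 + t ^+ 2 * k by lra.
have := @form_le_sqrt_gram (set_row i (row i V + t *: y) V) i.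
rewrite detE wE => /(_ Dt).
have tF0 : 0 < t * F by rewrite mulr_gt0.
rewrite -(@ler_pXn2r _ 2)// ?nnegrE ?sqrtr_ge0//; last by lra.
by rewrite sqr_sqrtr ?(ltW Dt)// sqrrD; have := sqr_ge0 (t * F); lra.
Qed.

(** Decomposing [x] along the plane of [V] and its orthogonal, only the tangent
    part survives, and it contributes its squared length. *)
Lemma form_derivation_ge0 V x : unit_simple g V -> w V = 1 ->
  0 <= \sum_i (x *m g *m V^T) 0 i * w (set_row i x V).
Proof.
move=> V1 wV1; set c := x *m g *m V^T; set G := V *m g *m V^T.
have Gu : G \in unitmx by rewrite unitmxE V1 unitr1.
pose a := c *m invmx G.
have aG : a *m V *m g *m V^T = c.
  by rewrite -2!mulmxA (mulmxA V) -/G /a mulmxKV.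
have orth : (x - a *m V) *m g *m V^T = 0.
  by rewrite !mulmxBl aG subrr.
have wx i : w (set_row i x V) = a 0 i.
  rewrite -[x](subrK (a *m V)) form_rowD first_cousin// add0r.
  rewrite mulmx_sum_row form_row_sum (bigD1 i)//= big1 ?addr0.
    by rewrite form_rowZ form_row_rows eqxx mul1r wV1 mulr1.
  by move=> k ki; rewrite form_rowZ form_row_rows eq_sym (negbTE ki) mul0r mulr0.
rewrite (_ : \sum_i _ = ((a *m V) *m g *m (a *m V)^T) 0 0).
  have [->|/gpos/ltW//] := eqVneq (a *m V) 0.
  by rewrite !mul0mx mxE.
rewrite trmx_mul mulmxA aG mxE; apply: eq_bigr => i _.
by rewrite wx [a^T _ _]mxE.
Qed.

End FirstCousin.

(** * The phi-Hessian of sums and composites *)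

Section DifferentiableMatrix.
Context {R : realType} {V : normedModType R}.

Lemma differentiable_bigsum (I : Type) (r : seq I) (P : pred I)
    (F : I -> V -> R) (u : V) : (forall i, differentiable (F i) u) ->
  differentiable (fun y => \sum_(i <- r | P i) F i y) u.
Proof.
move=> dF; elim: r => [|i r IHr].
  under eq_fun do rewrite big_nil; exact: differentiable_cst.
under eq_fun do rewrite big_cons; case: (P i) => //.
exact: differentiableD.
Qed.

Lemma differentiable_bigprod (I : Type) (r : seq I) (P : pred I)
    (F : I -> V -> R) (u : V) : (forall i, differentiable (F i) u) ->
  differentiable (fun y => \prod_(i <- r | P i) F i y) u.
Proof.
move=> dF; elim: r => [|i r IHr].
  under eq_fun do rewrite big_nil; exact: differentiable_cst.
under eq_fun do rewrite big_cons; case: (P i) => //.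
exact: differentiableM.
Qed.

Lemma differentiable_det m (M : V -> 'M[R]_m) u :
  (forall i j, differentiable (fun y => M y i j) u) ->
  differentiable (fun y => \det (M y)) u.
Proof.
move=> dM; apply: differentiable_bigsum => s.
apply: differentiableM; first exact: differentiable_cst.
exact: differentiable_bigprod.
Qed.

(** Cramer's rule near [u]. *)
Lemma differentiable_invmx m (M : V -> 'M[R]_m) u i j :
  (\forall y \near u, M y \in unitmx) ->
  (forall k l, differentiable (fun y => M y k l) u) ->
  differentiable (fun y => invmx (M y) i j) u.
Proof.
move=> Mu dM.
apply: (@near_eq_differentiable _ _ _
  (fun y => (\det (M y))^-1 * ((-1) ^+ (j + i) * \det (row' j (col' i (M y)))))).
  by apply: filterS Mu => y yu; rewrite /invmx yu !mxE.
apply: differentiableM.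
  apply: differentiableV; first exact: differentiable_det.
  by have := nbhs_singleton Mu; rewrite unitmxE unitfE.
apply: differentiableM; first exact: differentiable_cst.
apply: differentiable_det => k l.
by under eq_fun do rewrite !mxE.
Qed.

End DifferentiableMatrix.

Section ChartHessian.
Context {R : realType} {n : nat}.
Variables (U : set 'rV[R]_n) (g : 'rV[R]_n -> 'M[R]_n).
Hypothesis oU : open U.
Hypothesis gdiff : forall u, U u -> differentiable g u.
Hypothesis gT : forall u, U u -> (g u)^T = g u.
Hypothesis gpos : forall u (v : 'rV[R]_n), U u -> v != 0 ->
  0 < (v *m g u *m v^T) 0 0.
Implicit Types (h : 'rV[R]_n -> R) (u v : 'rV[R]_n) (W : 'rV[R]_n -> 'rV[R]_n).

Lemma met_unit u : U u -> g u \in unitmx.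
Proof.
move=> Uu; rewrite -row_free_unit -kermx_eq0; apply/negPn/negP.
move=> /rowV0Pn[v /sub_kermxP vg v0]; have := gpos Uu v0.
by rewrite vg mul0mx mxE ltxx.
Qed.

Lemma near_eq_gradient h1 h2 u : (\forall y \near u, h1 y = h2 y) ->
  \forall y \near u, gradient g h1 y = gradient g h2 y.
Proof.
move=> /near_join; apply: filterS => y /= h12; apply/rowP => k; rewrite !mxE.
by apply: eq_bigr => l _; congr (_ * _); apply: near_eq_derive.
Qed.

Lemma near_eq_levi_civita v W1 W2 u : (\forall y \near u, W1 y = W2 y) ->
  levi_civita g v W1 u = levi_civita g v W2 u.
Proof.
move=> W12; apply/rowP => k; rewrite !mxE; congr (_ + _).
  by apply: near_eq_derive; apply: filterS W12 => y ->.
by rewrite (nbhs_singleton W12).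
Qed.

Lemma derivable_gradient h u v k : smooth_on U h -> U u ->
  derivable (fun y => gradient g h y 0 k) u v.
Proof.
move=> hU Uu; apply: diff_derivable; under eq_fun do rewrite mxE.
apply: differentiable_bigsum => l; apply: differentiableM.
  apply: (@differentiable_invmx _ _ _ g u k l) => [|i j].
    by near=> y; apply: met_unit; near: y; exact: open_nbhs_nbhs.
  apply: (@differentiable_comp _ _ _ _ g (fun A : 'M[R]_n => A i j)).
    exact: gdiff.
  exact: differentiable_coord.
exact: (smooth_on_differentiable (partial_smooth_on l hU) Uu).
Unshelve. all: by end_near. Qed.

Lemma gradientD h1 h2 u : differentiable h1 u -> differentiable h2 u ->
  gradient g (h1 + h2) u = gradient g h1 u + gradient g h2 u.
Proof.
move=> d1 d2; apply/rowP => k; rewrite !mxE -big_split; apply: eq_bigr => l _ /=.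
by rewrite -mulrDr /partial deriveD//; exact: diff_derivable.
Qed.

Lemma gradient_comp d h u : smooth1 d -> differentiable h u ->
  gradient g (d 0%N \o h) u = d 1%N (h u) *: gradient g h u.
Proof.
move=> sd dh; apply/rowP => k; rewrite !mxE big_distrr; apply: eq_bigr => l _ /=.
by rewrite /partial derive_smooth1_comp// mulrCA.
Qed.

Lemma levi_civitaD v W1 W2 u :
  (forall k, derivable (fun y => W1 y 0 k) u v) ->
  (forall k, derivable (fun y => W2 y 0 k) u v) ->
  levi_civita g v (W1 + W2) u = levi_civita g v W1 u + levi_civita g v W2 u.
Proof.
move=> d1 d2; apply/rowP => k; rewrite !mxE addrACA; congr (_ + _).
  rewrite -deriveD//; congr ('D_v _ u); apply/funext => y.
  by rewrite !fctE mxE.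
rewrite -big_split; apply: eq_bigr => i _ /=.
rewrite -big_split; apply: eq_bigr => j _ /=.
by rewrite fctE mxE mulrDr.
Qed.

Lemma levi_civitaZ v (c : 'rV[R]_n -> R) W u : derivable c u v ->
  (forall k, derivable (fun y => W y 0 k) u v) ->
  levi_civita g v (fun y => c y *: W y) u =
  c u *: levi_civita g v W u + 'D_v c u *: W u.
Proof.
move=> dc dW; apply/rowP => k; rewrite !mxE mulrDr addrAC; congr (_ + _).
  under eq_fun do rewrite mxE.
  by rewrite (deriveM dc (dW k)) /GRing.scale/= [_ * 'D_v c u]mulrC.
rewrite big_distrr; apply: eq_bigr => i _ /=.
rewrite big_distrr; apply: eq_bigr => j _ /=.
by rewrite mxE mulrCA.
Qed.

Lemma near_smooth_diff h u : smooth_on U h -> U u ->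
  \forall y \near u, differentiable h y.
Proof.
move=> hU Uu; near=> y; apply: smooth_on_differentiable hU _.
by near: y; exact: open_nbhs_nbhs.
Unshelve. all: by end_near. Qed.

Lemma hessian_rowD v h1 h2 u : smooth_on U h1 -> smooth_on U h2 -> U u ->
  levi_civita g v (gradient g (h1 + h2)) u =
  levi_civita g v (gradient g h1) u + levi_civita g v (gradient g h2) u.
Proof.
move=> s1 s2 Uu; rewrite -levi_civitaD; last 2 first.
- by move=> k; exact: derivable_gradient.
- by move=> k; exact: derivable_gradient.
apply: near_eq_levi_civita.
have := near_smooth_diff s1 Uu; have := near_smooth_diff s2 Uu.
by apply: filterS2 => y d2 d1; exact: gradientD.
Qed.

Lemma hessian_row_comp v d h u : smooth1 d -> smooth_on U h -> U u ->
  levi_civita g v (gradient g (d 0%N \o h)) u =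
  d 1%N (h u) *: levi_civita g v (gradient g h) u +
  (d 2%N (h u) * 'D_v h u) *: gradient g h u.
Proof.
move=> sd hU Uu.
have dh : differentiable h u by exact: smooth_on_differentiable hU Uu.
rewrite -derive_smooth1_comp// -(levi_civitaZ (c := d 1%N \o h)); last 2 first.
- apply: diff_derivable; apply: differentiable_comp => //.
  exact: smooth1_differentiable.
- by move=> k; exact: derivable_gradient.
apply: near_eq_levi_civita.
by apply: filterS (near_smooth_diff hU Uu) => y dy; exact: gradient_comp.
Qed.

(** The defining property of the gradient, tested on the rows of [V]. *)
Lemma gradientP p (V : 'M[R]_(p, n)) h u i : U u -> differentiable h u ->
  (gradient g h u *m g u *m V^T) 0 i = 'D_(row i V) h u.
Proof.
move=> Uu dh; pose dv := \row_l partial l h u.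
have -> : gradient g h u = dv *m invmx (g u).
  rewrite -(gT Uu) -trmx_inv; apply/rowP => k; rewrite !mxE.
  by apply: eq_bigr => l _; rewrite !mxE mulrC.
rewrite mulmxKV ?met_unit// mxE derive_partialE//.
by apply: eq_bigr => l _; rewrite !mxE mulrC.
Qed.

End ChartHessian.

Section ChartTopology.
Context {R : realType} {n : nat} {M : topologicalType}.
Implicit Types (a : chart R n M) (W : set M) (x : M).

Lemma chart_image_open a W : open W -> open (a @` (chart_dom a `&` W)).
Proof.
move=> oW.
have := @chart_inv_continuous _ _ _ a.
have oC : open (a @` chart_dom a) by exact: chart_codom_open.
rewrite continuous_open_subspace// continuous_inP// => /(_ W oW).
congr (open _); apply/seteqP; split=> y.
- by move=> [[x ax <-]]; rewrite /= chart_mapK// => Wx; exists x.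
- move=> [x [ax Wx] <-]; split; first by exists x.
  by rewrite /= chart_mapK.
Qed.

Lemma chart_inv_continuous_at a x : chart_dom a x ->
  {for a x, continuous (chart_inv a)}.
Proof.
move=> ax; have := @chart_inv_continuous _ _ _ a.
rewrite continuous_open_subspace; last exact: chart_codom_open.
by apply; rewrite inE; exists x.
Qed.

Lemma chart_continuous_at a x : chart_dom a x -> {for x, continuous a}.
Proof.
move=> ax; have := @chart_map_continuous _ _ _ a.
rewrite continuous_open_subspace; last exact: chart_dom_open.
by apply; rewrite inE.
Qed.

Lemma near_chart_map a x (P : 'rV[R]_n -> Prop) : chart_dom a x ->
  (\forall u \near a x, P u) -> \forall y \near x, P (a y).
Proof. by move=> ax; apply: chart_continuous_at. Qed.

Lemma near_chart_inv a x (P : M -> Prop) : chart_dom a x ->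
  (\forall y \near x, P y) -> \forall u \near a x, P (chart_inv a u).
Proof.
move=> ax Px; have := chart_inv_continuous_at ax.
by rewrite /prop_for /continuous_at chart_mapK//; apply.
Qed.

End ChartTopology.

Section PshCalculus.
Context {R : realType} {n p : nat} (X : calibrated_manifold R n p).
Implicit Types (f : X -> R) (W : set X) (x : X) (d : nat -> R -> R).

Lemma near_eq_phi_hessian f1 f2 a x V : chart_dom (mfd_chart a) x ->
  (\forall y \near x, f1 y = f2 y) ->
  phi_hessian f1 a x V = phi_hessian f2 a x V.
Proof.
move=> ax f12; rewrite /phi_hessian.
have E v : levi_civita (cal_met X a) v
      (gradient (cal_met X a) (f1 \o chart_inv (mfd_chart a))) (mfd_chart a x) =
    levi_civita (cal_met X a) v
      (gradient (cal_met X a) (f2 \o chart_inv (mfd_chart a))) (mfd_chart a x).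
  apply: near_eq_levi_civita; apply: near_eq_gradient.
  exact: (near_chart_inv (P := fun y => f1 y = f2 y) ax f12).
by apply: eq_bigr => i _; rewrite E.
Qed.

Lemma psh_at_local f1 f2 x : (\forall y \near x, f1 y = f2 y) ->
  psh_at f1 x -> psh_at f2 x.
Proof. by move=> f12 f1x a V ax aV; rewrite -(near_eq_phi_hessian _ ax f12) f1x. Qed.

Lemma strictly_psh_at_local f1 f2 x : (\forall y \near x, f1 y = f2 y) ->
  strictly_psh_at f1 x -> strictly_psh_at f2 x.
Proof. by move=> f12 f1x a V ax aV; rewrite -(near_eq_phi_hessian _ ax f12) f1x. Qed.

Lemma strictly_psh_at_psh f x : strictly_psh_at f x -> psh_at f x.
Proof. by move=> fx a V ax aV; apply/ltW/fx. Qed.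

Section AtPoint.
Variables (W : set X) (x : X) (a : mfd_index X).
Hypotheses (oW : open W) (Wx : W x) (ax : chart_dom (mfd_chart a) x).
Let U := mfd_chart a @` (chart_dom (mfd_chart a) `&` W).
Let g := cal_met X a.

Let oU : open U. Proof. exact: chart_image_open. Qed.
Let Ux : U (mfd_chart a x). Proof. by exists x. Qed.
Let UC : U `<=` chart_codom (mfd_chart a).
Proof. by move=> _ [y [ay _] <-]; exists y. Qed.
Let gdiff u : U u -> differentiable g u.
Proof. by move=> /UC Cu; exact: (@met_smooth _ _ _ (cal_met X) a [::]). Qed.
Let gT u : U u -> (g u)^T = g u.
Proof. by move=> /UC; exact: met_sym. Qed.
Let gpos u (v : 'rV[R]_n) : U u -> v != 0 -> 0 < (v *m g u *m v^T) 0 0.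
Proof. by move=> /UC; exact: met_pos. Qed.
Let walt : alternating_form (cal_form X a (mfd_chart a x)).
Proof. by apply: form_alternating; exact: UC. Qed.

Lemma phi_hessianD f1 f2 V : smooth_fun W f1 -> smooth_fun W f2 ->
  phi_hessian (f1 + f2) a x V = phi_hessian f1 a x V + phi_hessian f2 a x V.
Proof.
move=> s1 s2; rewrite /phi_hessian -big_split; apply: eq_bigr => i _ /=.
rewrite -(form_rowD walt); congr (cal_form _ _ _ (set_row _ _ _)).
exact: (hessian_rowD oU gdiff gpos _ (s1 a) (s2 a)).
Qed.

(** The chain rule, with [q] the value of the form derived along grad f, which
    the calibration makes nonnegative. *)
Lemma phi_hessian_comp d f V : smooth1 d -> smooth_fun W f ->
  phi_plane a x V ->
  exists2 q, 0 <= q & phi_hessian (d 0%N \o f) a x V =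
    d 1%N (f x) * phi_hessian f a x V + d 2%N (f x) * q.
Proof.
move=> sd sf [V1 wV].
set u := mfd_chart a x in V1 wV *; set h := f \o chart_inv (mfd_chart a).
exists (\sum_i (gradient g h u *m g u *m V^T) 0 i *
        cal_form X a u (set_row i (gradient g h u) V)).
  apply: (@form_derivation_ge0 _ _ _ (g u)) => //.
  - by apply: gT.
  - by move=> v; apply: gpos.
  - by move=> V'; apply: cal_comass; exact: UC.
rewrite /phi_hessian !mulr_sumr -big_split; apply: eq_bigr => i _ /=.
rewrite -/u -/h -/g.
have -> : (d 0%N \o f) \o chart_inv (mfd_chart a) = d 0%N \o h by [].
rewrite (hessian_row_comp oU gdiff gpos _ sd (sf a))//.
rewrite (form_rowD walt) !(form_rowZ walt).
rewrite -/h; have -> : h u = f x by rewrite /h /= chart_mapK.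
rewrite (gradientP gT gpos)// ?mulrA//.
exact: smooth_on_differentiable (sf a) Ux.
Qed.

End AtPoint.

Lemma psh_atD f1 f2 W x : open W -> W x -> smooth_fun W f1 -> smooth_fun W f2 ->
  psh_at f1 x -> psh_at f2 x -> psh_at (f1 + f2) x.
Proof.
move=> oW Wx s1 s2 p1 p2 a V ax aV.
by rewrite (phi_hessianD oW Wx ax _ s1 s2) addr_ge0//; [exact: p1|exact: p2].
Qed.

Lemma strictly_psh_atDr f1 f2 W x : open W -> W x ->
  smooth_fun W f1 -> smooth_fun W f2 ->
  psh_at f1 x -> strictly_psh_at f2 x -> strictly_psh_at (f1 + f2) x.
Proof.
move=> oW Wx s1 s2 p1 p2 a V ax aV.
by rewrite (phi_hessianD oW Wx ax _ s1 s2) ltr_wpDl//; [exact: p1|exact: p2].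
Qed.

Lemma psh_at_comp d f W x : open W -> W x -> smooth1 d -> smooth_fun W f ->
  0 <= d 1%N (f x) -> 0 <= d 2%N (f x) -> psh_at f x -> psh_at (d 0%N \o f) x.
Proof.
move=> oW Wx sd sf d1 d2 pf a V ax aV.
have [q q0 ->] := phi_hessian_comp oW Wx ax sd sf aV.
by rewrite addr_ge0 ?mulr_ge0//; exact: pf.
Qed.

Lemma strictly_psh_at_comp d f W x : open W -> W x -> smooth1 d ->
  smooth_fun W f -> 0 < d 1%N (f x) -> 0 <= d 2%N (f x) ->
  strictly_psh_at f x -> strictly_psh_at (d 0%N \o f) x.
Proof.
move=> oW Wx sd sf d1 d2 pf a V ax aV.
have [q q0 ->] := phi_hessian_comp oW Wx ax sd sf aV.
by rewrite ltr_pwDl ?mulr_ge0// mulr_gt0//; exact: pf.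
Qed.

Lemma smooth_funD f1 f2 W : open W -> smooth_fun W f1 -> smooth_fun W f2 ->
  smooth_fun W (f1 + f2).
Proof.
by move=> oW s1 s2 a; apply: smooth_onD; first exact: chart_image_open.
Qed.

Lemma smooth_fun_comp d f W : open W -> smooth1 d -> smooth_fun W f ->
  smooth_fun W (d 0%N \o f).
Proof.
move=> oW sd sf a; apply: (smooth_on_comp _ sd (sf a)).
exact: chart_image_open.
Qed.

Lemma smooth_fun_cst W c : open W -> smooth_fun W (cst c : X -> R).
Proof. by move=> oW a; apply: smooth_on_cst; exact: chart_image_open. Qed.

Lemma smooth_fun_subset W W' f : W `<=` W' -> smooth_fun W' f -> smooth_fun W f.
Proof.
move=> WW' sf a; apply: smooth_on_subset (sf a).
by apply: image_subset => x [ax Wx]; split=> //; exact: WW'.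
Qed.

Lemma smooth_fun_local f W :
  (forall x, W x -> exists W' f', [/\ open W', W' x, smooth_fun W' f'
    & forall y, W' y -> f y = f' y]) -> smooth_fun W f.
Proof.
move=> sf a; apply: smooth_on_local => _ [x [ax Wx] <-].
have [W' [f' [oW' W'x sf' ff']]] := sf x Wx.
exists (mfd_chart a @` (chart_dom (mfd_chart a) `&` W')).
exists (f' \o chart_inv (mfd_chart a)); split.
- apply: open_nbhs_nbhs; split; first exact: chart_image_open.
  by exists x.
- by exists x.
- exact: sf'.
- by move=> _ [y [ay W'y] <-]; rewrite /= chart_mapK// ff'.
Qed.

Lemma smooth_fun_continuous f W x : open W -> W x -> smooth_fun W f ->
  {for x, continuous f}.
Proof.
move=> oW Wx sf; have [a ax] := mfd_cover x.
have fE : \forall y \near x,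
    (f \o chart_inv (mfd_chart a)) (mfd_chart a y) = f y.
  near=> y; rewrite /= chart_mapK//; near: y.
  by apply: open_nbhs_nbhs; split=> //; exact: chart_dom_open.
apply: (cvg_trans (near_eq_cvg fE)).
rewrite -(nbhs_singleton fE).
apply: (@continuous_comp _ _ _ _ (f \o chart_inv (mfd_chart a))).
  exact: chart_continuous_at.
apply: differentiable_continuous; apply: smooth_on_differentiable (sf a) _.
by exists x.
Unshelve. all: by end_near. Qed.

(** A constant is a composite with a function whose two derivatives vanish. *)
Lemma psh_cst (c : R) (x : X) : psh_at (cst c) x.
Proof.
have W : open [set: X] by exact: openT.
have sd : smooth1 (affines 0 c : nat -> R -> R) by exact: smooth1_affine.
have -> : (cst c : X -> R) = affines 0 c 0%N \o cst c.
  by apply/funext => y; rewrite /= mul0r add0r.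
move=> a V ax aV.
have [q q0 ->] := phi_hessian_comp W I ax sd (smooth_fun_cst c W) aV.
by rewrite /= !mul0r addr0.
Qed.

End PshCalculus.

(** * Compact exhaustions and separation from the hull *)

Section CompactExhaustion.
Context {T : topologicalType}.
Hypothesis T2 : @second_countable T.
Hypothesis Tloc : forall x : T, exists2 C, compact C & nbhs x C.
Implicit Types (A C : set T) (x : T).

(** A compact set is attached to each basic open set that lies in one; those
    basic sets already cover the space. *)
Lemma countable_compact_cover : exists C : nat -> set T,
  (forall i, compact (C i)) /\ forall x, exists i, nbhs x (C i).
Proof.
have [B /countable_injP[r rinj] [Bo Bnbhs]] := T2.
have /choice[C CP] : forall i, exists C, compact C /\
    forall U D, B U -> r U = i -> compact D -> U `<=` D -> U `<=` C.
  move=> i; have [[U [D [BU rU cD UD]]]|no] :=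
      pselect (exists U D, [/\ B U, r U = i, compact D & U `<=` D]).
    exists D; split=> // U' D' BU' rU' _ _; rewrite (rinj U' U) ?inE//.
    by rewrite rU.
  exists set0; split=> [|U D BU rU cD UD]; first exact: compact0.
  by case: no; exists U, D.
exists C; split=> [i|x]; first by case: (CP i).
have [D cD /Bnbhs[U [BU Ux] UD]] := Tloc x.
exists (r U); apply: (@filterS _ _ _ U).
  by apply: (CP (r U)).2 cD UD.
by apply: open_nbhs_nbhs; split=> //; exact: Bo.
Qed.

(** Finitely many terms of the countable cover suffice; [D m] increases with
    [m], so the covering form of compactness applies to [m] at infinity. *)
Lemma compact_nbhd A : compact A ->
  exists2 C, compact C & forall x, A x -> nbhs x C.
Proof.
have [C [cC nC]] := countable_compact_cover => cA.
pose D m := \big[setU/set0]_(i < m) C i.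
have := (compact_near_coveringP A).1 cA nat \oo (fun m x => nbhs x (D m)) _.
case=> [x _|m _ /(_ m (leqnn m)) mA]; last first.
  by exists (D m) => //; exact: bigsetU_compact.
have [i xi] := nC x.
exists ([set y | nbhs y (C i)], [set m | (i < m)%N]) => /=.
  by split; [exact: near_join|exists i.+1].
move=> [y m] /= [yi im]; apply: filterS yi.
by move=> z Cz; rewrite /D -bigcup_mkord; exists i.
Qed.

Variable H : set T -> set T.
Hypothesis Hcompact : forall A, compact A -> compact (closure (H A)).

(** [H] will be the convex hull: the next compact set is a neighborhood of the
    previous one and of its hull, and takes in one more set of a countable
    cover. *)
Lemma compact_exhaustion : exists K : nat -> set T, [/\ forall i, compact (K i),
  forall i x, K i x -> nbhs x (K i.+1),
  forall i x, H (K i) x -> nbhs x (K i.+1) & forall x, exists i, K i x].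
Proof.
have [C [cC nC]] := countable_compact_cover.
have /choice[N NP] : forall A, exists D, compact A ->
    compact D /\ forall x, A x -> nbhs x D.
  move=> A; have [/compact_nbhd[D cD AD]|] := pselect (compact A); last by exists set0.
  by exists D.
pose K := fix K i :=
  if i is j.+1 then N (K j `|` closure (H (K j)) `|` C j) else set0.
have cK i : compact (K i).
  elim: i => [|i IHi]; first exact: compact0.
  apply: (NP _ _).1; apply: compactU => //; apply: compactU => //.
  exact: Hcompact.
have nK i x : (K i `|` closure (H (K i)) `|` C i) x -> nbhs x (K i.+1).
  apply: (NP _ _).2; apply: compactU => //; apply: compactU => //.
  exact: Hcompact.
exists K; split=> // [i x Kx|i x Hx|x].
- by apply: nK; left; left.
- by apply: nK; left; right; exact: subset_closure.
- have [i Cx] := nC x; exists i.+1; apply: nbhs_singleton; apply: nK; right.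
  exact: nbhs_singleton.
Qed.

End CompactExhaustion.

(** Closed balls in charts. *)
Lemma manifold_locally_compact (R : realType) n (X : manifold R n) (x : X) :
  exists2 C, compact C & nbhs x C.
Proof.
have [i ax] := mfd_cover x; set a := mfd_chart i in ax.
have oC : open (a @` chart_dom a) by exact: chart_codom_open.
have : nbhs (a x) (a @` chart_dom a).
  by apply: open_nbhs_nbhs; split=> //; exists x.
move=> /nbhs_closedballP[r rC].
have cB : compact (closed_ball (a x) r%:num).
  apply: bounded_closed_compact; last exact: closed_ball_closed.
  exists (`|a x| + r%:num); split=> [|M rM y]; first by rewrite num_real.
  rewrite closed_ballE// /closed_ball_ /= => xy; apply/ltW; apply: le_lt_trans rM.
  by rewrite -[y](subrK (a x)) addrC (le_trans (ler_normD _ _))// lerD2l distrC.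
have nB : \forall y \near x, closed_ball (a x) r%:num (a y).
  have nB : nbhs (a x) (closed_ball (a x) r%:num).
    apply: (@filterS _ _ _ (ball (a x) r%:num)); first exact: subset_closed_ball.
    exact: nbhsx_ballx.
  exact: (near_chart_map (P := closed_ball (a x) r%:num) ax nB).
exists (chart_inv a @` closed_ball (a x) r%:num).
  apply: continuous_compact => //.
  apply: (continuous_subspaceW rC); exact: (@chart_inv_continuous _ _ _ a).
near=> y; exists (a y); last first.
  apply: chart_mapK; near: y; apply: open_nbhs_nbhs; split=> //.
  exact: chart_dom_open.
by near: y.
Unshelve. all: by end_near. Qed.

Section Convexity.
Context {R : realType} {n p : nat} (X : calibrated_manifold R n p).
Implicit Types (f g : X -> R) (A B K : set X) (x : X).

Lemma PSH_D f g : PSH f -> PSH g -> PSH (f + g).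
Proof.
move=> [sf pf] [sg pg]; split; first exact: smooth_funD openT sf sg.
by move=> x; apply: (psh_atD openT I sf sg).
Qed.

Lemma PSH_cst (c : R) : PSH (cst c : X -> R).
Proof.
by split; [exact: smooth_fun_cst openT|move=> x; exact: psh_cst].
Qed.

Lemma PSH_comp d f : smooth1 d -> (forall t, 0 <= d 1%N t) ->
  (forall t, 0 <= d 2%N t) -> PSH f -> PSH (d 0%N \o f).
Proof.
move=> sd d1 d2 [sf pf]; split; first exact: smooth_fun_comp openT sd sf.
by move=> x; apply: (psh_at_comp openT I sd sf).
Qed.

Lemma PSH_scale c f : 0 <= c -> PSH f -> PSH (fun x => c * f x).
Proof.
move=> c0 Pf; rewrite (_ : (fun x => _) = affines c 0 0%N \o f).
  apply: PSH_comp => //; exact: smooth1_affine.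
by apply/funext => x; rewrite /= addr0.
Qed.

Lemma PSH_continuous f : PSH f -> continuous f.
Proof. by move=> [sf _] x; apply: (smooth_fun_continuous openT I sf). Qed.

Lemma closed_sublevel f c : continuous f -> closed [set x | f x <= c].
Proof.
move=> cf; apply: (@closed_comp _ _ f [set y | y <= c]) => [x _|]; first exact: cf.
exact: closed_le.
Qed.

Definition PSH_cutoff A : set (X -> R) :=
  [set g | [/\ PSH g, forall x, 0 <= g x & forall x, A x -> g x = 0]].

(** The function given by the definition of the hull is cut off at a level
    between its supremum on [A] and its value at [x], then scaled. *)
Lemma separate_point A x c : ~ convex_hull A x ->
  exists2 g, PSH_cutoff A g & c < g x.
Proof.
move=> /existsNP[f /not_implyP[Pf /negP]]; rewrite -ltNge => Afx.
have [t At tx] : exists2 t, (forall y, A y -> f y <= t) & t < f x.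
  have ub y : A y -> ((f y)%:E <= ereal_sup [set (f z)%:E | z in A])%E.
    by move=> Ay; apply: ereal_sup_ubound; exists y.
  move: Afx ub; case: (ereal_sup _) => [t| |] // tx ub.
    by exists t => // y /ub; rewrite lee_fin.
  exists (f x - 1); last by rewrite ltrBlDr ltrDl.
  by move=> y /ub; rewrite leeNy_eq.
pose g y := theta (f y - t).
have gx : 0 < g x by rewrite theta_gt0// subr_gt0.
have Pg : PSH g.
  have -> : g = thetas 0%N \o (affines 1 (- t) 0%N \o f).
    by apply/funext => y; rewrite /= mul1r.
  apply: PSH_comp; [exact: smooth1_theta|exact: thetas1_ge0|exact: thetas2_ge0|].
  by apply: PSH_comp => //; exact: smooth1_affine.
exists (fun y => ((`|c| + 1) / g x) * g y); last first.
  by rewrite divfK ?gt_eqF// (le_lt_trans (ler_norm c))// ltrDl.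
have s0 : 0 <= (`|c| + 1) / g x by rewrite divr_ge0 ?(ltW gx)// addr_ge0.
split; first exact: PSH_scale.
- by move=> y; rewrite mulr_ge0// theta_ge0.
- move=> y /At ty; have yt : f y - t <= 0 by rewrite subr_le0.
  by rewrite [g y]theta_le0// mulr0.
Qed.

(** The functions in [PSH_cutoff A] are directed for the pointwise order, since
    a sum dominates its terms.  Each point of [B] has a neighborhood on which all
    sufficiently large ones exceed [c], and compactness makes this uniform. *)
Lemma separate_compact A B c : compact B ->
  (forall x, B x -> ~ convex_hull A x) ->
  exists2 g, PSH_cutoff A g & forall x, B x -> c < g x.
Proof.
move=> cB BA.
pose F := filter_from (PSH_cutoff A)
  (fun g => [set g' | PSH_cutoff A g' /\ forall y, g y <= g' y]).
have FF : Filter F.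
  apply: filter_from_filter.
    by exists (cst 0); split=> //; exact: PSH_cst.
  move=> g1 g2 [P1 g10 A1] [P2 g20 A2]; exists (g1 + g2); first split.
  - exact: PSH_D.
  - by move=> x; rewrite addr_ge0 ?g10 ?g20.
  - by move=> x Ax; rewrite !fctE A1// A2// addr0.
  move=> g' [N' gg']; split; split=> // y; apply: le_trans (gg' y).
    by rewrite lerDl g20.
  by rewrite lerDr g10.
have := (compact_near_coveringP B).1 cB _ F (fun g x => c < g x) FF.
case=> [x Bx|g Ng /(_ g)]; last first.
  by move=> gB; exists g => // x Bx; apply: gB.
have [g Ng gx] := separate_point c (BA x Bx).
exists ([set y | c < g y],
        [set g' | PSH_cutoff A g' /\ forall y, g y <= g' y]) => /=.
  split; last by exists g.
  have [Pg _ _] := Ng.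
  have := PSH_continuous Pg; rewrite continuousP => /(_ [set y | c < y]) oc.
  apply: open_nbhs_nbhs; split=> //; apply: oc.
  exact: open_gt.
by move=> [y g'] /= [cg [_ gg']]; exact: lt_le_trans (gg' y).
Qed.

Lemma PSH_local f : (forall x, exists2 f', PSH f' & \forall y \near x, f y = f' y) ->
  PSH f.
Proof.
move=> lf; split.
  apply: smooth_fun_local => x _; have [f' [sf' _] ff'] := lf x.
  exists [set y | f y = f' y]°, f'; split=> //.
  - exact: open_interior.
  - exact: smooth_fun_subset sf'.
  - by move=> y /interior_subset.
move=> x; have [f' [_ pf'] ff'] := lf x; apply: psh_at_local (pf' x).
by apply: filterS ff' => y ->.
Qed.

(** On [K i] only the terms of index below [i] of the sum of the [g j] count,
    which makes the sum locally finite; at a point that enters the exhaustion at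
    step [i.+2] the term [g i] alone exceeds [i]. *)
Lemma psh_exhaustion :
  (forall K : set X, compact K -> relatively_compact (convex_hull K)) ->
  exists2 f : X -> R, PSH f & proper_exhaustion f.
Proof.
move=> hull; have [K [cK nK hK coverK]] := compact_exhaustion
  (@mfd_second_countable _ _ X) (@manifold_locally_compact _ _ X) hull.
have subK i j x : (i <= j)%N -> K i x -> K j x.
  move=> /subnKC <- Kx; elim: (j - i)%N => [|k IHk]; first by rewrite addn0.
  by rewrite addnS; apply: nbhs_singleton; exact: nK.
have /choice[g gP] : forall i, exists g, PSH_cutoff (K i) g /\
    forall x, K i.+2 x -> ~ K i.+1 x -> i%:R < g x.
  move=> i; have [||g Ng gi] := @separate_compact (K i)
    (K i.+2 `&` ~` (K i.+1)°) i%:R.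
  - apply: compact_closedI => //; apply: open_closedC; exact: open_interior.
  - by move=> x [_ nx] /hK.
  - exists g; split=> // x K2 K1; apply: gi; split=> //.
    by move=> /interior_subset.
pose S m : X -> R := fun x => \sum_(0 <= j < m) g j x.
have PS m : PSH (S m).
  elim: m => [|m IHm].
    rewrite (_ : S 0%N = cst 0); first exact: PSH_cst.
    by apply/funext => x; rewrite /S big_nil.
  have [[Pg _ _] _] := gP m.
  rewrite (_ : S m.+1 = S m + g m); first exact: PSH_D IHm Pg.
  by apply/funext => x; rewrite /S big_nat_recr.
have Sstable i m x : K i x -> (i <= m)%N -> S m x = S i x.
  move=> Kx im; rewrite /S (big_cat_nat (n := i))//=.
  rewrite [X in _ + X](_ : _ = 0) ?addr0//.
  rewrite big_nat_cond big1// => j /andP[/andP[ij _] _].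
  by have [[_ _ g0] _] := gP j; apply: g0; apply: subK Kx.
have /choice[N NP] := coverK.
pose f x := S (N x) x.
have fE i x : K i x -> f x = S i x.
  move=> Kx; rewrite /f; case: (leqP i (N x)) => [iN|/ltnW Ni].
    exact: Sstable.
  by apply/esym/Sstable.
have Pf : PSH f.
  apply: PSH_local => x; exists (S (N x).+1) => //.
  by apply: filterS (nK _ _ (NP x)) => y; exact: fE.
exists f => // c.
have [M cM] : exists M : nat, c <= M%:R.
  exists (Num.bound `|c|); rewrite (le_trans (ler_norm c))// ltW//.
  exact: archi_boundP.
apply: (@subclosed_compact _ _ (K M.+2)) => //.
  by apply: closed_sublevel; exact: PSH_continuous.
move=> x /= fxc.
have [m [Kx Kmin]] : exists m, K m x /\ forall j, (j < m)%N -> ~ K j x.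
  have ex : exists m, `[< K m x >] by have [m Km] := coverK x; exists m; apply/asboolP.
  exists (ex_minn ex); case: ex_minnP => m /asboolP Km mmin; split=> // j jm.
  by move=> /asboolP /mmin; rewrite leqNgt jm.
case: (leqP m M.+2) => [mM|]; first exact: subK Kx.
case: m Kx Kmin => [|[|i]]// Kx Kmin; rewrite !ltnS => Mi; exfalso.
have [[_ _ _] /(_ x Kx (Kmin _ (ltnSn _))) gi] := gP i.
have : g i x <= f x.
  rewrite (fE _ _ Kx) /S big_mkord.
  rewrite (bigD1 (Ordinal (leqnSn i.+1 : (i < i.+2)%N)))//= lerDl.
  by apply: sumr_ge0 => j _; have [[_ + _] _] := gP j; apply.
rewrite leNgt => /negP; apply; apply: le_lt_trans gi.
by apply: le_trans fxc _; apply: le_trans cM _; rewrite ler_nat ltnW.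
Qed.

End Convexity.

(** * Gluing at infinity *)

Lemma compact_upper_bound (R : realType) (T : topologicalType) (A : set T)
    (f : T -> R) : compact A -> (forall x, A x -> {for x, continuous f}) ->
  exists2 M, 0 <= M & forall x, A x -> f x <= M.
Proof.
move=> cA cf.
suff bnd : \forall M \near +oo, A `<=` (fun x => f x <= M).
  have [M [AM M0]] := filter_ex (filterI bnd (nbhs_pinfty_ge (num_real 0))).
  by exists M.
apply: ((compact_near_coveringP A).1 cA R (pinfty_nbhs R) (fun M x => f x <= M)).
move=> x Ax; exists ([set y | f y <= f x + 1], [set M | f x + 1 <= M]) => /=.
  split; last by apply: nbhs_pinfty_ge; exact: num_real.
  apply: (cf x Ax [set z | z <= f x + 1]).
  have fx1 : f x < f x + 1 by rewrite ltrDl.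
  by apply: filterS (lt_nbhsl fx1) => y; exact: ltW.
by move=> [y M] /= [fy fM]; exact: le_trans fy fM.
Qed.

Section Gluing.
Context {R : realType} {n p : nat} (X : calibrated_manifold R n p).
Implicit Types (f v : X -> R) (K : set X).

(** The exhaustion itself is one of the functions that define the hull. *)
Lemma exhaustion_hull f K : PSH f -> proper_exhaustion f -> compact K ->
  relatively_compact (convex_hull K).
Proof.
move=> Pf ef cK.
have cf := PSH_continuous Pf.
have [M _ KM] := compact_upper_bound cK (fun x _ => cf x).
apply: (@subclosed_compact _ _ [set x | f x <= M]) => //.
  exact: closed_closure.
have : closed [set x | f x <= M] by apply: closed_sublevel; exact: PSH_continuous.
rewrite closure_id => ->; apply: closureS => x /(_ f Pf) /= fx.
rewrite -lee_fin; apply: le_trans fx _; apply: ge_ereal_sup => _ [y Ky <-].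
by rewrite lee_fin KM.
Qed.

Lemma glue_at_infinity f v K : PSH f -> proper_exhaustion f -> compact K ->
  smooth_fun (~` K) v -> (forall x, (~` K) x -> strictly_psh_at v x) ->
  exists g, PSH g /\ proper_exhaustion g /\
    exists K', compact K' /\ forall x, (~` K') x -> strictly_psh_at g x.
Proof.
move=> Pf ef cK sv pv; have [sf pf] := Pf; have cf := PSH_continuous Pf.
have [c0 _ Kc0] := compact_upper_bound cK (fun x _ => cf x).
pose c := c0 + 1.
have oK : open (~` K).
  by apply: closed_openC; apply: compact_closed cK; exact: mfd_hausdorff.
have fK x : c <= f x -> (~` K) x.
  by move=> cx /Kc0; rewrite /c in cx; lra.
have fK' x : c0 < f x -> (~` K) x.
  by move=> cx /Kc0; lra.
(* positivity is what replaces a lower bound for v at infinity *)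
pose E x := expR (v x).
have sE : smooth_fun (~` K) E.
  exact: (smooth_fun_comp oK (@smooth1_expR R) sv).
have pE x : (~` K) x -> strictly_psh_at E x.
  move=> Kx; apply: (strictly_psh_at_comp oK Kx (@smooth1_expR R) sv).
  - exact: expR_gt0.
  - exact: expR_ge0.
  - exact: pv.
have [M M0 EM] : exists2 M, 0 <= M & forall x, c <= f x <= c + 1 -> E x <= M.
  have cA : compact [set x | c <= f x <= c + 1].
    apply: (@subclosed_compact _ _ [set x | f x <= c + 1]) => //.
      rewrite (_ : [set x | _] = [set x | f x <= c + 1] `&` [set x | c <= f x]).
        apply: closedI; first exact: closed_sublevel.
        apply: (@closed_comp _ _ f [set y | c <= y]) => [x _|]; first exact: cf.
        exact: closed_ge.
      by apply/seteqP; split => x /=; [move=> /andP[]|move=> [-> ->]].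
    by move=> x /= /andP[].
  apply: compact_upper_bound cA _ => x /= /andP[/fK Kx _].
  exact: smooth_fun_continuous oK Kx sE.
(* from c + 1/2 to c + 1 the term mu f grows by more than M, the bound of E *)
pose mu := M + M + 1; pose b := - (M + mu * (c + 2^-1)).
pose h : X -> R := E + (affines mu b 0%N \o f).
have hE x : h x = E x + (mu * f x + b) by [].
have mu0 : 0 <= mu by rewrite /mu; lra.
have sfK : smooth_fun (~` K) f by apply: smooth_fun_subset sf.
have safK : smooth_fun (~` K) (affines mu b 0%N \o f).
  exact: (smooth_fun_comp oK (smooth1_affine mu b) sfK).
have sh : smooth_fun (~` K) h by exact: smooth_funD.
have ph x : (~` K) x -> strictly_psh_at h x.
  move=> Kx; rewrite /h addrC; apply: (strictly_psh_atDr oK Kx) => //.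
    apply: (psh_at_comp oK Kx (smooth1_affine mu b) sfK) => //.
  exact: pE.
have h_le0 x : c <= f x <= c + 2^-1 -> h x <= 0.
  move=> /andP[cx xc]; rewrite hE /b.
  have : E x <= M by apply: EM; rewrite cx; lra.
  have : mu * f x <= mu * (c + 2^-1) by rewrite ler_wpM2l.
  lra.
have h_gt0 x : c + 1 <= f x -> 0 < h x.
  move=> cx; rewrite hE /b.
  have : 0 < E x by exact: expR_gt0.
  have : mu * (c + 1) <= mu * f x by rewrite ler_wpM2l.
  rewrite !mulrDr /mu; lra.
pose g x := if f x <= c then f x else f x + theta (h x).
have fg x : f x <= g x.
  by rewrite /g; case: ifP => // _; rewrite lerDl theta_ge0.
pose th := thetas 0%N \o h.
have sth : smooth_fun (~` K) th by exact: (smooth_fun_comp oK smooth1_theta sh).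
have near_out x : c < f x -> \forall y \near x, (f + th) y = g y.
  move=> cx; have : \forall y \near x, c < f y.
    exact: (cf x [set z | c < z] (lt_nbhsr cx)).
  by apply: filterS => y cy; rewrite /g leNgt cy.
have near_in x : f x < c + 2^-1 -> \forall y \near x, f y = g y.
  move=> xc; have : \forall y \near x, f y < c + 2^-1.
    exact: (cf x [set z | z < c + 2^-1] (lt_nbhsl xc)).
  apply: filterS => y yc; rewrite /g; case: leP => // cy.
  by rewrite theta_le0 ?addr0// h_le0// !ltW.
have Pg : PSH g.
  split.
    apply: smooth_fun_local => x _.
    have [xc|cx] := ltP (f x) (c + 2^-1).
      exists [set y | f y = g y]°, f; split.
      - exact: open_interior.
      - exact: near_in.
      - exact: smooth_fun_subset sf.
      - by move=> y /interior_subset /esym.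
    have cx' : c < f x by lra.
    exists ([set y | (f + th) y = g y]° `&` ~` K), (f + th); split.
    - by apply: openI => //; exact: open_interior.
    - by split; [exact: near_out|exact/fK/ltW].
    - apply: (@smooth_fun_subset _ _ _ _ _ (~` K)); first exact: subIsetr.
      exact: smooth_funD.
    - by move=> y [/interior_subset /esym].
  move=> x; have [xc|cx] := ltP (f x) (c + 2^-1).
    exact: psh_at_local (near_in x xc) (pf x).
  have cx' : c < f x by lra.
  have Kx : (~` K) x by exact/fK/ltW.
  apply: psh_at_local (near_out x cx') _.
  apply: (psh_atD oK Kx) => //.
  apply: (psh_at_comp oK Kx smooth1_theta sh).
  - exact: thetas1_ge0.
  - exact: thetas2_ge0.
  - exact: strictly_psh_at_psh (ph x Kx).
exists g; split=> //; split.
  move=> t; apply: (@subclosed_compact _ _ [set x | f x <= t]) => //.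
    by apply: closed_sublevel; exact: PSH_continuous.
  by move=> x /=; apply: le_trans.
exists [set x | f x <= c + 1]; split=> // x /= /negP; rewrite -ltNge => cx.
have cx' : c < f x by lra.
have Kx : (~` K) x by exact/fK/ltW.
apply: strictly_psh_at_local (near_out x cx') _.
apply: (strictly_psh_atDr oK Kx) => //.
apply: (strictly_psh_at_comp oK Kx smooth1_theta sh).
- by apply/thetas1_gt0/h_gt0/ltW.
- exact: thetas2_ge0.
- exact: ph.
Qed.

End Gluing.

Theorem theorem3p8 (R : realType) (n p : nat) (hp : (0 < p)%N)
    (X : calibrated_manifold R n p)
    (hnoncompact : ~ compact [set: X]) (hconnected : connected [set: X]) :
  ((forall K : set X, compact K -> relatively_compact (convex_hull K)) /\
   (exists (K : set X) (f : X -> R),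
      compact K /\ smooth_fun (~` K) f /\
      forall x : X, (~` K) x -> strictly_psh_at f x))
  <->
  (exists f : X -> R,
     PSH f /\ proper_exhaustion f /\
     exists K : set X, compact K /\
       forall x : X, (~` K) x -> strictly_psh_at f x).
Proof.
split=> [[hull [K [v [cK [sv pv]]]]]|[f [Pf [ef [K [cK pK]]]]]].
  have [f Pf ef] := psh_exhaustion hull.
  exact: glue_at_infinity Pf ef cK sv pv.
split=> [K' cK'|]; first exact: exhaustion_hull Pf ef cK'.
exists K, f; split=> //; split=> //.
by apply: smooth_fun_subset (proj1 Pf).
Qed.
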